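(* An iterated function system $\mathcal{S}=\{S_i\}_{i=1}^k$ of similarities on $\mathbb{R}$ satisfies the finite neighbour condition if and only if it satisfies the convex generalized finite type condition.
   Context: An iterated function system (IFS) $\mathcal{S}=\{S_i\}_{i=1}^k$ is a finite set of similarities $S_i(x)=r_ix+d_i:\mathbb{R}\to\mathbb{R}$ with $0<|r_i|<1$ and $k\ge 2$. Its self-similar set $K$ is the unique non-empty compact set with $K=\bigcup_{j=1}^k S_j(K)$. Standing assumption: $K$ is not a singleton and (after rescaling and translating) the convex hull of $K$ is $[0,1]$. Words: $\Sigma=\{1,\dots,k\}$ and $\Sigma^*$ is the set of all finite words on $\Sigma$ (the empty word corresponds to the identity map, with ratio $1$). For $\sigma=(\sigma_1,\dots,\sigma_j)$ put $S_\sigma=S_{\sigma_1}\circ\cdots\circ S_{\sigma_j}$, $r_\sigma=\prod_{i=1}^j r_{\sigma_i}$ and (for $j\ge1$) $\sigma^-=(\sigma_1,\dots,\sigma_{j-1})$. For $\alpha>0$ let $\Lambda_\alpha=\{\sigma\in\Sigma^*: |r_\sigma|<\alpha\le |r_{\sigma^-}|\}$. Net intervals and neighbour sets: for $\alpha>0$ let $h_1<\dots<h_{s(\alpha)}$ be the distinct elements of $\{S_\sigma(0),S_\sigma(1):\sigma\in\Lambda_\alpha\}$ and $\mathcal{F}_\alpha=\{[h_j,h_{j+1}]:1\le j<s(\alpha),\ (h_j,h_{j+1})\cap K\ne\emptyset\}$ (net intervals of generation $\alpha$). For $\Delta\in\mathcal{F}_\alpha$, $T_\Delta(x)=rx+a$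 is the unique such map with $r>0$ and $T_\Delta([0,1])=\Delta$. The neighbour set of $\Delta\in\mathcal{F}_\alpha$ is the set of maps $V_\alpha(\Delta)=\{T_\Delta^{-1}\circ S_\sigma:\sigma\in\Lambda_\alpha,\ S_\sigma([0,1])\supseteq\Delta\}$. Finite neighbour condition: the collection of all neighbour sets $\{V_\alpha(\Delta):\alpha>0,\ \Delta\in\mathcal{F}_\alpha\}$ is finite. Convex generalized finite type condition: for $V\subseteq\mathbb{R}$ let $\mathcal{E}_{\mathcal{S}}(V)=\bigcup_{\alpha>0}\{S_\sigma^{-1}\circ S_\tau:\sigma,\tau\in\Lambda_\alpha,\ S_\sigma(V)\cap S_\tau(V)\ne\emptyset\}$. A set $V$ is invariant if $S_j(V)\subseteq V$ for all $j$. $\mathcal{S}$ is of generalized finite type if $\mathcal{E}_{\mathcal{S}}(V)$ is finite for some non-empty bounded invariant open set $V$; it satisfies the convex generalized finite type condition if this holds with $V$ the interior of the convex hull of $K$, i.e. (under the standing assumption) if $\mathcal{E}_{\mathcal{S}}((0,1))$ is finite. *)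

(* Defs.v *)
From HB Require Import structures.
From mathcomp Require Import all_boot all_order all_algebra.
From mathcomp Require Import all_classical all_reals all_analysis.

Set Implicit Arguments.
Unset Strict Implicit.
Unset Printing Implicit Defensive.

Import Order.TTheory GRing.Theory Num.Theory.
Import numFieldNormedType.Exports.

Local Open Scope classical_set_scope.
Local Open Scope ring_scope.

Record IFS (R : realType) := {
  ifs_size : nat;
  ratio : 'I_ifs_size -> R;
  shift : 'I_ifs_size -> R;
  ifs_size_ge2 : (2 <= ifs_size)%N;
  ratio_bounds : forall i, 0 < `|ratio i| < 1 }.

Section IteratedFunctionSystems.
Context {R : realType}.
Implicit Types (S : IFS R) (K V : set R) (alpha a b : R).

Definition sim S (i : 'I_(ifs_size S)) (x : R) : R := ratio i * x + shift i.

(* By Hutchinson's theorem exactly one set satisfies this predicate. *)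
Definition self_similar_set S K : Prop :=
  [/\ K !=set0, compact K & K = \bigcup_j (@sim S j @` K)].

Definition convex_hull (A : set R) : set R :=
  smallest (@convex_set R R^o) A.

Definition word S := seq 'I_(ifs_size S).

Definition word_map S (s : word S) : R -> R :=
  foldr (fun i f => @sim S i \o f) idfun s.

Definition word_ratio S (s : word S) : R := \prod_(i <- s) ratio i.

Definition parent S (s : word S) : word S := take (size s).-1 s.

(* The empty word has no parent, hence never belongs to [Lambda S alpha]. *)
Definition Lambda S alpha : set (word S) :=
  [set s | s != [::] /\ `|word_ratio s| < alpha <= `|word_ratio (parent s)|].
Arguments Lambda : clear implicits.

Definition endpoints S alpha : set R :=
  [set h | exists2 s, Lambda S alpha s & h = word_map s 0 \/ h = word_map s 1].

(* [endpoints S alpha] is a finite set h_1 < ... < h_s, so [a, b] has the form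
   [h_j, h_{j+1}] iff a < b are endpoints with no endpoint strictly between. *)
Definition net_interval S K alpha a b : Prop :=
  [/\ endpoints S alpha a, endpoints S alpha b, a < b,
      endpoints S alpha `&` `]a, b[ = set0 & `]a, b[ `&` K !=set0].

(* The increasing affine map of [0, 1] onto [a, b]; see [net_map_image]. *)
Definition net_map a b (x : R) : R := (b - a) * x + a.

Definition neighbour_set S alpha a b : set (R -> R) :=
  [set f | exists s, [/\ Lambda S alpha s,
                         `[a, b] `<=` word_map s @` `[0, 1]
                       & f = pinv setT (net_map a b) \o word_map s]].

Definition finite_neighbour_condition S K : Prop :=
  finite_set [set V | exists alpha a b,
    [/\ 0 < alpha, net_interval S K alpha a b & V = neighbour_set S alpha a b]].

Definition neighbour_maps S V : set (R -> R) :=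
  [set f | exists alpha s t,
    [/\ 0 < alpha, Lambda S alpha s, Lambda S alpha t,
        (word_map s @` V) `&` (word_map t @` V) !=set0
      & f = pinv setT (word_map s) \o word_map t]].

Definition convex_generalized_finite_type S K : Prop :=
  finite_set (neighbour_maps S (interior (convex_hull K))).

(* [pinv setT f] is a two-sided inverse for the maps f used above. *)

Lemma pinv_affine (r d : R) (f : R -> R) : r != 0 ->
  f =1 (fun x => r * x + d) -> pinv setT f =1 (fun y => (y - d) / r).
Proof.
move=> r0 fE y; have fK : f ((y - d) / r) = y by rewrite fE mulrC divfK ?subrK.
have finj : {in setT &, injective f}.
  by move=> u v _ _; rewrite !fE => /addIr /(mulfI r0).
by rewrite -{1}fK pinvKV ?inE.
Qed.

Lemma word_ratio_neq0 S (s : word S) : word_ratio s != 0.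
Proof.
rewrite /word_ratio; elim: s => [|i s IH]; first by rewrite big_nil oner_neq0.
by rewrite big_cons mulf_neq0 // -normr_gt0; case/andP: (ratio_bounds i).
Qed.

Lemma word_mapE S (s : word S) x :
  word_map s x = word_ratio s * x + word_map s 0.
Proof.
rewrite /word_ratio; elim: s => [|i s IH] /=; first by rewrite big_nil mul1r addr0.
by rewrite /sim big_cons IH mulrDr mulrA addrA.
Qed.

Lemma pinv_word_map S (s : word S) y :
  pinv setT (word_map s) y = (y - word_map s 0) / word_ratio s.
Proof. exact: (pinv_affine (word_ratio_neq0 s) (word_mapE s)). Qed.

Lemma pinv_net_map a b y : a < b ->
  pinv setT (net_map a b) y = (y - a) / (b - a).
Proof.
by move=> ab; apply: (@pinv_affine (b - a) a) => //; rewrite subr_eq0 gt_eqF.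
Qed.

Lemma net_map_image a b : a < b -> net_map a b @` `[0, 1] = `[a, b]%classic.
Proof.
move=> ab; have ba : 0 < b - a by rewrite subr_gt0.
apply/seteqP; split=> [_ [x + <-]|y] /=; rewrite !in_itv /= => /andP[h0 h1].
  rewrite /net_map lerDr mulr_ge0 ?(ltW ba) //= -lerBrDr.
  by rewrite ler_piMr // ltW.
exists ((y - a) / (b - a)); last by rewrite /net_map mulrC divfK ?subrK ?gt_eqF.
by rewrite /= in_itv /= divr_ge0 ?subr_ge0 ?(ltW ab) //= ler_pdivrMr // mul1r lerB.
Qed.

End IteratedFunctionSystems.

(* Main.v *)
(** Let T be the increasing affine map of [0, 1] onto a net interval [a, b].

    If S_s(0, 1) and S_t(0, 1) meet, their overlap starts at the left end u of
    one of the two images.  As K is perfect and contains 0 and 1, it accumulates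
    at u from the right, so u starts a net interval contained in the overlap,
    and S_s^-1 S_t = (T^-1 S_s)^-1 (T^-1 S_t) is built from two neighbours.

    Conversely let S_s[0, 1] cover the net interval.  Then
    T^-1 S_t = (S_s^-1 T)^-1 (S_s^-1 S_t), and S_s^-1 T is determined by
    S_s^-1 a and S_s^-1 b, each of which is 0, 1, or the image of 0 or 1 under
    some S_s^-1 S_w with S_s(0, 1) and S_w(0, 1) overlapping.  Thus all
    neighbours lie in one finite set, which has finitely many subsets. *)
Require Import Defs.
From mathcomp Require Import all_boot all_order all_algebra.
From mathcomp Require Import all_classical all_reals all_analysis.
From mathcomp Require Import finmap ring lra.
Set Implicit Arguments.
Unset Strict Implicit.

Import Order.TTheory GRing.Theory Num.Theory.
Import numFieldNormedType.Exports.
Local Open Scope classical_set_scope.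
Local Open Scope ring_scope.

(** * Finite power sets, extrema of compact sets, and the ends of a convex hull *)

Lemma finite_set_subsets (T : Type) (F : set T) :
  finite_set F -> finite_set [set V : set T | V `<=` F].
Proof.
(* Finite sets of type [{fset T}] require a choice structure, which is put on [T] classically. *)
elim/Pchoice: T => T in F *.
move=> /finite_fsetP[X ->].
apply: (sub_finite_set _ (finite_image (fun Y : {fset T} => [set` Y])
  (finite_fset (fpowerset X)))) => V /= VX.
have /finite_fsetP[Y VY] : finite_set V by exact: sub_finite_set VX _.
exists Y => //=; rewrite fpowersetE; apply/fsubsetP => y yY.
by apply: VX; rewrite VY.
Qed.

(** The extreme value theorem for the identity; it serves both for [K] and for finite sets of
    endpoints. *)
Lemma compact_least (R : realType) (A : set R) : A !=set0 -> compact A ->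
  exists2 m, A m & forall x, A x -> m <= x.
Proof.
move=> A0 cA; have [|m] := compact_EVT_min (f := @idfun R) A0 cA.
  by apply: continuous_subspaceT => x; exact: cvg_id.
by move=> /set_mem Am mA; exists m => // x Ax; exact/mA/mem_set.
Qed.

Lemma compact_greatest (R : realType) (A : set R) : A !=set0 -> compact A ->
  exists2 m, A m & forall x, A x -> x <= m.
Proof.
move=> A0 cA; have [|m] := compact_EVT_max (f := @idfun R) A0 cA.
  by apply: continuous_subspaceT => x; exact: cvg_id.
by move=> /set_mem Am mA; exists m => // x Ax; exact/mA/mem_set.
Qed.

Lemma convex_set_itvcc (R : realType) (a b : R) :
  @convex_set R R^o `[a, b]%classic.
Proof.
move=> x y t /set_mem + /set_mem; rewrite /= !in_itv /=.
move=> /andP[ax xb] /andP[ay yb]; apply/mem_set; rewrite /= in_itv /=.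
have [t0 t1] : 0 <= t%:num /\ t%:num <= 1 by split; [exact: ge0|exact: le1].
suff: a <= t%:num * (x : R) + (1 - t%:num) * (y : R) <= b by [].
by apply/andP; split; nra.
Qed.

(** The least and greatest points m, M of [K] bound a convex set [m, M] containing [K], hence
    containing the hull. So m = [a] and M = [b]. *)
Lemma hull_ends {R : realType} {K : set R} {a b : R} : a <= b ->
  K !=set0 -> compact K -> convex_hull K = `[a, b]%classic ->
  [/\ K `<=` `[a, b], K a & K b].
Proof.
move=> ab K0 cK hK.
have Kab : K `<=` `[a, b] by rewrite -hK; exact: sub_gen_smallest.
have [m Km mK] := compact_least K0 cK.
have [M KM MK] := compact_greatest K0 cK.
have sub : `[a, b]%classic `<=` `[m, M]%classic.
  rewrite -hK; apply: smallest_sub; first exact: convex_set_itvcc.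
  by move=> x Kx /=; rewrite in_itv /= mK // MK.
have := Kab _ Km; have := Kab _ KM.
have /sub : `[a, b]%classic a by rewrite /= in_itv /= lexx.
have /sub : `[a, b]%classic b by rewrite /= in_itv /= lexx andbT.
rewrite /= !in_itv /= => /andP[_ bM] /andP[ma _].
move=> /andP[_ Mb] /andP[am _].
split=> //.
  by have -> : a = m by apply/le_anti; rewrite ma am.
by have -> : b = M by apply/le_anti; rewrite Mb bM.
Qed.

(** * Images of the unit interval under words, and finiteness in each generation *)

Section Words.
Context {R : realType} {S : IFS R}.
Implicit Types (s t : word S) (x y alpha : R).

Lemma word_mapB s x y :
  word_map s x - word_map s y = word_ratio s * (x - y).
Proof. by rewrite (word_mapE s x) (word_mapE s y); ring. Qed.

(** A negative ratio reverses orientation, so either end of the image may come from 0. *)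
Definition word_left s := Num.min (word_map s 0) (word_map s 1).
Definition word_right s := Num.max (word_map s 0) (word_map s 1).

Lemma word_endsP s :
  (0 < word_ratio s /\ word_left s = word_map s 0
    /\ word_right s = word_map s 0 + word_ratio s) \/
  (word_ratio s < 0 /\ word_left s = word_map s 0 + word_ratio s
    /\ word_right s = word_map s 0).
Proof.
rewrite /word_left /word_right (word_mapE s 1) mulr1 [_ s + _]addrC.
have := word_ratio_neq0 s; rewrite neq_lt => /orP[r|r]; [right|left].
  by rewrite min_r ?max_l ?gerDl ?ltW.
by rewrite min_l ?max_r ?lerDl ?ltW.
Qed.

Lemma word_map_cc s y :
  (word_map s @` `[0, 1]) y <-> word_left s <= y <= word_right s.
Proof.
have r0 := word_ratio_neq0 s.
split=> [[x /= + <-]|].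
  rewrite in_itv /= word_mapE => /andP[x0 x1].
  by case: (word_endsP s) => -[r [-> ->]]; apply/andP; split; nra.
move=> /andP[ly yr]; exists ((y - word_map s 0) / word_ratio s); last first.
  by rewrite word_mapE; field.
rewrite /= in_itv /=; move: ly yr.
case: (word_endsP s) => -[r [-> ->]] ly yr.
  by rewrite ler_pdivlMr // ler_pdivrMr //; apply/andP; split; lra.
by rewrite ler_ndivlMr // ler_ndivrMr //; apply/andP; split; lra.
Qed.

Lemma word_map_oo s y :
  (word_map s @` `]0, 1[) y <-> word_left s < y < word_right s.
Proof.
have r0 := word_ratio_neq0 s.
split=> [[x /= + <-]|].
  rewrite in_itv /= word_mapE => /andP[x0 x1].
  by case: (word_endsP s) => -[r [-> ->]]; apply/andP; split; nra.
move=> /andP[ly yr]; exists ((y - word_map s 0) / word_ratio s); last first.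
  by rewrite word_mapE; field.
rewrite /= in_itv /=; move: ly yr.
case: (word_endsP s) => -[r [-> ->]] ly yr.
  by rewrite ltr_pdivlMr // ltr_pdivrMr //; apply/andP; split; lra.
by rewrite ltr_ndivlMr // ltr_ndivrMr //; apply/andP; split; lra.
Qed.

Lemma word_left_lt_right s : word_left s < word_right s.
Proof. by case: (word_endsP s) => -[r [-> ->]]; lra. Qed.

Lemma word_leftE s : word_left s = word_map s 0 \/ word_left s = word_map s 1.
Proof. by rewrite /word_left minElt; case: ifP; [left|right]. Qed.

Lemma word_rightE s :
  word_right s = word_map s 0 \/ word_right s = word_map s 1.
Proof. by rewrite /word_right maxElt; case: ifP; [right|left]. Qed.

Lemma endpoints_word_left alpha s : Lambda alpha s ->
  endpoints S alpha (word_left s).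
Proof. by move=> As; exists s => //; exact: word_leftE. Qed.

Lemma endpoints_word_right alpha s : Lambda alpha s ->
  endpoints S alpha (word_right s).
Proof. by move=> As; exists s => //; exact: word_rightE. Qed.

Lemma word_map_rcons s i x : word_map (rcons s i) x = word_map s (sim i x).
Proof. by elim: s => //= j s ->. Qed.

Lemma parent_rcons s i : parent (rcons s i) = s.
Proof. by rewrite /parent size_rcons -cats1 take_size_cat. Qed.

Lemma size_parent s : size (parent s) = (size s).-1.
Proof. by rewrite size_take; case: size => //= n; rewrite ltnSn. Qed.

Lemma word_ratio_geometric : exists2 q : R, 0 < q < 1 &
  forall s, `|word_ratio s| <= q ^+ size s.
Proof.
(* The default value 1/2 keeps [q] positive and is itself below 1. *)
pose q : R := \big[Num.max/2^-1]_(i : 'I_(ifs_size S)) `|Defs.ratio i|.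
have rq (i : 'I_(ifs_size S)) : `|Defs.ratio i| <= q by exact: le_bigmax.
have q2 : 2^-1 <= q by exact: bigmax_ge_id.
exists q.
  apply/andP; split; first by apply: lt_le_trans q2; lra.
  rewrite /q; apply/(@bigmax_ltP _ R); split=> [|i _]; first lra.
  by case/andP: (ratio_bounds i).
elim=> [|i s IH]; rewrite /word_ratio ?big_nil ?normr1 // big_cons normrM.
by rewrite exprS ler_pM.
Qed.

Lemma word_ratio_le1 s : `|word_ratio s| <= 1.
Proof.
have [q /andP[q0 q1] /(_ s) /le_trans] := word_ratio_geometric; apply.
by rewrite exprn_ile1 // ltW.
Qed.

Lemma word_ratio_small x : 0 < x ->
  exists n, forall s, (n <= size s)%N -> `|word_ratio s| < x.
Proof.
move=> x0; have [q /andP[q0 q1] rq] := word_ratio_geometric.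
have /cvg_expr/cvgr0Pnorm_lt/(_ _ x0)[n _ nq] : `|q| < 1 by rewrite gtr0_norm.
exists n => s ns; apply: le_lt_trans (rq s) _.
by have := nq _ ns; rewrite /= ger0_norm // exprn_ge0 // ltW.
Qed.

Lemma Lambda_le1 alpha s : Lambda alpha s -> alpha <= 1.
Proof. by move=> [_ /andP[_ /le_trans]]; apply; exact: word_ratio_le1. Qed.

(** The parent of such a word has ratio at least [alpha] in modulus, so it has fewer than [n]
    letters once all words of length at least [n] have ratio below [alpha]. This bounds the length
    of the word by [n]. *)
Lemma finite_Lambda alpha : 0 < alpha -> finite_set (@Lambda R S alpha).
Proof.
move=> alpha0; have [n nP] := word_ratio_small alpha0.
pose V : set (word S) := [set (w : seq _) | w in [set: n.-bseq 'I_(ifs_size S)]].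
apply: (@sub_finite_set _ _ V); last exact: finite_image.
move=> s [s0 /andP[_ as_]]; have sn : (size s <= n)%N.
  rewrite leqNgt; apply/negP => ns.
  have := nP (parent s); rewrite size_parent ltNge as_.
  by case: (size s) ns => // m; rewrite ltnS => /[swap] /[apply].
by exists (Bseq sn).
Qed.

Lemma finite_endpoints alpha : 0 < alpha -> finite_set (endpoints S alpha).
Proof.
move=> /finite_Lambda fL.
apply: (@sub_finite_set _ _ ((@word_map R S ^~ 0) @` @Lambda R S alpha `|`
  (@word_map R S ^~ 1) @` @Lambda R S alpha)).
  by move=> _ [s Ls [->|->]]; [left|right]; exists s.
by rewrite finite_setU; split; exact: finite_image.
Qed.

End Words.

(** * Points of the attractor and the position of net intervals *)

Section Attractor.
Context {R : realType} {S : IFS R} {K : set R}.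
Hypothesis K_self_similar : self_similar_set S K.
Implicit Types (s t : word S) (x y e alpha : R).

Lemma word_map_stable s x : K x -> K (word_map s x).
Proof.
have [_ _ KE] := K_self_similar.
by elim: s x => //= i s IH x /IH Kx; rewrite KE; exists i => //;
  exists (word_map s x).
Qed.

Lemma attractor_coded n x : K x ->
  exists s, size s = n /\ (word_map s @` K) x.
Proof.
have [_ _ KE] := K_self_similar.
elim: n x => [|n IH] x Kx; first by exists [::]; split=> //; exists x.
have [s [<- [y + <-]]] := IH x Kx.
rewrite {1}KE => -[i _ [z Kz <-]]; exists (rcons s i).
by rewrite size_rcons; split=> //; exists z => //; rewrite word_map_rcons.
Qed.

(** Code x by longer and longer words and stop when the ratio first drops below [alpha]. The bound
    [alpha <= 1] lets the empty word start the process, and decay of the ratios makes it stop. *)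
Lemma attractor_Lambda alpha x : 0 < alpha <= 1 -> K x ->
  exists2 s : word S, Lambda alpha s & (word_map s @` K) x.
Proof.
move=> /andP[alpha0 alpha1] Kx.
have [_ _ KE] := K_self_similar.
have [n nP] := @word_ratio_small _ S _ alpha0.
(* Induction on [n]: either the coding has stopped, or a word of length [n] still has ratio at least
   [alpha]. The chosen [n] excludes the latter. *)
suff [//|[s [sn + _]]] : (exists2 s : word S, Lambda alpha s & (word_map s @` K) x)
    \/
    exists s, [/\ size s = n, alpha <= `|word_ratio s| & (word_map s @` K) x].
  by rewrite leNgt nP // sn.
elim: n {nP} => [|n [|[s [sn rs [y + <-]]]]]; first 2 last.
- rewrite {1}KE => -[i _ [z Kz <-]].
  have Ks : (word_map (rcons s i) @` K) (word_map s (sim i z)).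
    by exists z => //; rewrite word_map_rcons.
  have [r|r] := leP alpha `|word_ratio (rcons s i)|; [right|left].
    by exists (rcons s i); rewrite size_rcons sn.
  exists (rcons s i) => //; split; first by case: (s).
  by rewrite parent_rcons r.
- right; exists [::]; split=> //; last by exists x.
  by rewrite /word_ratio big_nil normr1.
- by left.
Qed.

Hypothesis K_hull : convex_hull K = `[0, 1]%classic.

Let K_ends : [/\ K `<=` `[0, 1], K 0 & K 1].
Proof. by have [K0 cK _] := K_self_similar; exact: hull_ends. Qed.

(** A long word s codes x, so S_s[0, 1] has length below [e]. It contains the two distinct points
    S_s(0) and S_s(1) of [K], and one of them differs from x. *)
Lemma attractor_perfect x e : K x -> 0 < e ->
  exists y, [/\ K y, y != x & `|y - x| < e].
Proof.
have [K01 K0 K1] := K_ends.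
move=> Kx e0; have [n nP] := @word_ratio_small _ S _ e0.
have [s [sn [z Kz zx]]] := attractor_coded n Kx.
have re : `|word_ratio s| < e by apply: nP; rewrite sn.
have := K01 _ Kz; rewrite /= in_itv /= => /andP[z0 z1].
have near c : 0 <= c <= 1 -> `|word_map s c - x| < e.
  move=> /andP[c0 c1]; rewrite -zx word_mapB normrM; apply: le_lt_trans re.
  by rewrite ler_piMr // ler_norml; apply/andP; split; lra.
have [sx|sx] := eqVneq (word_map s 0) x; last first.
  exists (word_map s 0); split; [exact: word_map_stable|by []|].
  by apply: near; rewrite lexx ler01.
exists (word_map s 1); split; [exact: word_map_stable| |].
  rewrite -sx word_mapE mulr1 -subr_eq0 addrK; exact: word_ratio_neq0.
by apply: near; rewrite lexx ler01.
Qed.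

(** The left end is S_s(c) with c = 0 or 1, and c is an accumulation point of [K]. Points of [K]
    near c are sent into S_s[0, 1], hence to the right of its left end. *)
Lemma attractor_right_of_word_left s e : word_left s < e ->
  exists2 x, K x & word_left s < x < e.
Proof.
have [K01 K0 K1] := K_ends.
move=> le.
have [c Kc cE] : exists2 c, K c & word_left s = word_map s c.
  by case: (word_leftE s) => ->; [exists 0|exists 1].
have r0 := word_ratio_neq0 s.
have : 0 < (e - word_left s) / `|word_ratio s|.
  by rewrite divr_gt0 ?subr_gt0 ?normr_gt0.
move=> /(attractor_perfect Kc)[y [Ky yc]].
rewrite ltr_pdivlMr ?normr_gt0 // -normrM => yce.
exists (word_map s y); first exact: word_map_stable.
have /word_map_cc/andP[ly _] : (word_map s @` `[0, 1]) (word_map s y).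
  by exists y => //; exact: K01.
have yE : word_map s y - word_left s = (y - c) * word_ratio s.
  by rewrite cE word_mapB mulrC.
rewrite -yE in yce; rewrite lt_neqAle ly andbT; apply/andP; split.
  rewrite eq_sym -subr_eq0 yE mulf_neq0 // subr_eq0 //.
by move: yce; rewrite ger0_norm ?subr_ge0 // ltrD2r.
Qed.


(** Take for [b] the least endpoint beyond the left end, which exists by finiteness. Accumulation of
    [K] from the right shows that the gap meets [K]. *)
Lemma net_interval_from_word_left alpha s v : 0 < alpha -> Lambda alpha s ->
  endpoints S alpha v -> word_left s < v ->
  exists2 b, net_interval S K alpha (word_left s) b & b <= v.
Proof.
move=> alpha0 Ls Ev uv.
pose B := endpoints S alpha `&` [set x | word_left s < x].
have [|b [Eb ub] bB] := @compact_least _ B (ex_intro _ v (conj Ev uv)).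
  by apply: finite_compact; apply: finite_setIl; exact: finite_endpoints.
exists b; last by apply: bB.
have [x Kx uxb] := attractor_right_of_word_left ub.
split=> //; [exact: endpoints_word_left| |by exists x; split].
apply/seteqP; split=> // y [Ey /=]; rewrite in_itv /= => /andP[uy yb].
by have := bB y (conj Ey uy); rewrite leNgt yb.
Qed.

(** The overlap starts at the left end of one of the two images and stops at an endpoint, so the net
    interval beginning there cannot outrun it. *)
Lemma net_interval_in_overlap alpha s t : 0 < alpha ->
  Lambda alpha s -> Lambda alpha t ->
  Num.max (word_left s) (word_left t) < Num.min (word_right s) (word_right t) ->
  exists a b, [/\ net_interval S K alpha a b,
    `[a, b] `<=` word_map s @` `[0, 1] & `[a, b] `<=` word_map t @` `[0, 1]].
Proof.
move=> alpha0 Ls Lt uv.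
have [w Lw wE] : exists2 w : word S, Lambda alpha w &
    Num.max (word_left s) (word_left t) = word_left w.
  by rewrite maxElt; case: ifP; [exists t|exists s].
have Ev : endpoints S alpha (Num.min (word_right s) (word_right t)).
  by rewrite minElt; case: ifP => _; exact: endpoints_word_right.
rewrite wE in uv.
have [b net bv] := net_interval_from_word_left alpha0 Lw Ev uv.
have : word_left s <= word_left w by rewrite -wE le_max lexx.
have : word_left t <= word_left w by rewrite -wE le_max lexx orbT.
move: bv; rewrite le_min => /andP[bs bt] wt ws.
exists (word_left w), b; split=> // y; rewrite /= in_itv /= => /andP[wy yb];
  by apply/word_map_cc/andP; split; lra.
Qed.

(** Some S_s[0, 1] of this generation contains a point of [K] inside the net interval. Its ends are
    endpoints, so neither lies strictly between [a] and [b]. *)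
Lemma net_interval_covered alpha a b : 0 < alpha ->
  net_interval S K alpha a b ->
  exists2 s : word S, Lambda alpha s & word_left s <= a /\ b <= word_right s.
Proof.
have [K01 _ _] := K_ends.
move=> alpha0 [[s0 /Lambda_le1 alpha1 _] _ ab Eab [x [/= + Kx]]].
rewrite in_itv /= => /andP[ax xb].
have [|s Ls [y Ky yx]] := attractor_Lambda (alpha := alpha) _ Kx.
  by rewrite alpha0.
have /word_map_cc/andP[lx xr] : (word_map s @` `[0, 1]) x.
  by exists y => //; exact: K01.
have notin c : endpoints S alpha c -> ~~ (a < c < b).
  move=> Ec; apply/negP => acb; have : set0 c by rewrite -Eab.
  by [].
exists s => //; split; rewrite leNgt; apply/negP => lt.
  move/negP: (notin _ (endpoints_word_left Ls)); apply.
  by apply/andP; split; lra.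
move/negP: (notin _ (endpoints_word_right Ls)); apply.
by apply/andP; split; lra.
Qed.

End Attractor.

(** * From finitely many neighbour sets to finitely many overlap maps *)

Lemma finite_neighbour_finite_type (R : realType) (S : IFS R) (K : set R)
    (K_self_similar : self_similar_set S K)
    (K_hull : convex_hull K = `[0, 1]%classic) :
  finite_neighbour_condition S K -> convex_generalized_finite_type S K.
Proof.
rewrite /finite_neighbour_condition; set VV := [set V | _] => VVfin.
pose G := \bigcup_(V in VV) V.
have Gfin : finite_set G.
  (* The hypothesis bounds the number of neighbour sets; each of them is finite because its
     generation of words is. *)
  apply: bigcup_finite => // _ [alpha [a [b [alpha0 _ ->]]]].
  apply: (@sub_finite_set _ _ ((fun s : word S =>
    pinv setT (net_map a b) \o word_map s) @` @Lambda R S alpha)).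
    by move=> _ [s [Ls _ ->]]; exists s.
  by apply: finite_image; exact: finite_Lambda.
apply: (@sub_finite_set _ _
  [set pinv setT f \o g | f in G & g in G]); last first.
  exact: finite_image2.
rewrite /neighbour_maps K_hull interior_itv.
move=> _ [alpha [s [t [alpha0 Ls Lt [x [xs xt]] ->]]]].
move: xs xt => /word_map_oo xs /word_map_oo xt.
have uv :
    Num.max (word_left s) (word_left t) < Num.min (word_right s) (word_right t).
  by rewrite gt_max !lt_min; move: xs xt => /andP[? ?] /andP[? ?];
     rewrite !word_left_lt_right /=; apply/andP; split; lra.
have [a [b [net abs abt]]] :=
  net_interval_in_overlap K_self_similar K_hull alpha0 Ls Lt uv.
have Vab : VV (neighbour_set S alpha a b) by exists alpha, a, b.
exists (pinv setT (net_map a b) \o word_map s).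
  by exists (neighbour_set S alpha a b) => //; exists s.
exists (pinv setT (net_map a b) \o word_map t).
  by exists (neighbour_set S alpha a b) => //; exists t.
have [_ _ ab _ _] := net; have ba : b - a != 0 by rewrite subr_eq0 gt_eqF.
have r0 := word_ratio_neq0 s.
apply/funext => y; rewrite /= pinv_word_map pinv_net_map //.
(* The map T^-1 S_s is affine with these coefficients; with its inverse explicit, T cancels. *)
rewrite (@pinv_affine _ (word_ratio s / (b - a))
  ((word_map s 0 - a) / (b - a))).
- by field; rewrite r0.
- by rewrite mulf_neq0 ?invr_eq0.
by move=> z; rewrite /= pinv_net_map // word_mapE; field.
Qed.

(** * From finitely many overlap maps to finitely many neighbour sets *)

(** An end of S_s[0, 1] pulls back to 0 or 1. Otherwise [c] lies strictly inside it and is an end of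
    some S_t[0, 1], so the open images overlap on one side of [c], and the pullback is a value of
    S_s^-1 S_t at 0 or 1. *)
Lemma pinv_word_map_endpoint (R : realType) (S : IFS R) alpha c (s : word S) :
  0 < alpha -> Lambda alpha s -> endpoints S alpha c ->
  word_left s <= c <= word_right s ->
  [\/ pinv setT (word_map s) c = 0, pinv setT (word_map s) c = 1 |
    exists2 e, neighbour_maps S `]0, 1[ e &
      pinv setT (word_map s) c = e 0 \/ pinv setT (word_map s) c = e 1].
Proof.
move=> alpha0 Ls [t Lt cE] /andP[lc cr].
have r0 := word_ratio_neq0 s.
have at_end : c = word_map s 0 \/ c = word_map s 1 ->
    pinv setT (word_map s) c = 0 \/ pinv setT (word_map s) c = 1.
  rewrite pinv_word_map => -[->|->]; [left|right]; first by rewrite subrr mul0r.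
  by rewrite word_mapB subr0 mulr1 divff.
have [cl|cl] := eqVneq c (word_left s).
  have [|?|?] := at_end; [|by constructor 1|by constructor 2].
  by rewrite cl; exact: word_leftE.
have [c_r|c_r] := eqVneq c (word_right s).
  have [|?|?] := at_end; [|by constructor 1|by constructor 2].
  by rewrite c_r; exact: word_rightE.
have {}lc : word_left s < c by rewrite lt_neqAle eq_sym cl.
have {}cr : c < word_right s by rewrite lt_neqAle c_r.
constructor 3; exists (pinv setT (word_map s) \o word_map t); last first.
  by case: cE => ->; [left|right].
have lr := word_left_lt_right t.
have tc : word_left t = c \/ word_right t = c.
  case: cE => ->; rewrite /word_left /word_right;
    case: leP; (by left) || by right.
exists alpha, s, t; split=> //.
pose u := Num.max (word_left s) (word_left t).
pose v := Num.min (word_right s) (word_right t).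
have uv : u < v.
  by rewrite /u /v gt_max !lt_min; case: tc => tc; rewrite ?word_left_lt_right;
    repeat (apply/andP; split); lra.
have [us ut] : word_left s <= u /\ word_left t <= u.
  by rewrite !le_max !lexx orbT.
have [vs vt] : v <= word_right s /\ v <= word_right t.
  by rewrite !ge_min !lexx orbT.
by exists ((u + v) / 2); split; apply/word_map_oo/andP; split; lra.
Qed.

Lemma finite_type_finite_neighbour (R : realType) (S : IFS R) (K : set R)
    (K_self_similar : self_similar_set S K)
    (K_hull : convex_hull K = `[0, 1]%classic) :
  convex_generalized_finite_type S K -> finite_neighbour_condition S K.
Proof.
rewrite /convex_generalized_finite_type K_hull interior_itv => Efin.
set E := neighbour_maps _ _ in Efin.
(* All possible values of S_s^-1 at endpoints lying in S_s[0, 1]. *)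
pose P := [set 0; 1] `|` ((fun e : R -> R => e 0) @` E `|` (fun e => e 1) @` E).
have Pfin : finite_set P.
  by rewrite /P !finite_setU; split=> //; split; exact: finite_image.
(* For p = S_s^-1 a and q = S_s^-1 b, the map T^-1 S_s sends z to (z - p) / (q - p), so composing it
   with e = S_s^-1 S_t gives T^-1 S_t. Other pairs only enlarge this finite set. *)
pose F := [set (fun x => (e x - pq.1) / (pq.2 - pq.1)) | pq in P `*` P & e in E].
have Ffin : finite_set F by apply: finite_image2 => //; exact: finite_setX.
apply: sub_finite_set (finite_set_subsets Ffin).
move=> _ [alpha [a [b [alpha0 net ->]]]].
have [s Ls [la br]] := net_interval_covered K_self_similar K_hull alpha0 net.
have [Ea Eb ab _ _] := net.
have Pend c : endpoints S alpha c -> word_left s <= c <= word_right s ->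
    P (pinv setT (word_map s) c).
  move=> Ec lcr;
  have [->|->|[e Ee [->|->]]] := pinv_word_map_endpoint alpha0 Ls Ec lcr.
  - by left; left.
  - by left; right.
  - by right; left; exists e.
  - by right; right; exists e.
have Pa : P (pinv setT (word_map s) a).
  by apply: Pend => //; apply/andP; split; lra.
have Pb : P (pinv setT (word_map s) b).
  by apply: Pend => //; apply/andP; split; lra.
have r0 := word_ratio_neq0 s; have ba : b - a != 0 by rewrite subr_eq0 gt_eqF.
move=> _ [t [Lt abt ->]].
exists (pinv setT (word_map s) a, pinv setT (word_map s) b) => //.
exists (pinv setT (word_map s) \o word_map t).
  (* Both closed images contain [a, b], so its midpoint lies in both open images. *)
  exists alpha, s, t; split=> //; exists ((a + b) / 2); split.
    by apply/word_map_oo/andP; split; lra.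
  have /word_map_cc/andP[ta _] : (word_map t @` `[0, 1]) a.
    by apply: abt; rewrite /= in_itv /= lexx ltW.
  have /word_map_cc/andP[_ tb] : (word_map t @` `[0, 1]) b.
    by apply: abt; rewrite /= in_itv /= lexx ltW.
  by apply/word_map_oo/andP; split; lra.
apply/funext => y; rewrite /= !pinv_word_map pinv_net_map //.
by field; rewrite r0 ba.
Qed.

Unset Implicit Arguments.

Theorem theorem3p4 (R : realType) (S : IFS R) (K : set R)
    (K_self_similar : self_similar_set S K)
    (K_not_singleton : forall x : R, K <> [set x])
    (K_hull : convex_hull K = `[0, 1]%classic) :
  finite_neighbour_condition S K <-> convex_generalized_finite_type S K.
Proof.
split; first exact: finite_neighbour_finite_type.
exact: finite_type_finite_neighbour.
Qed.
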